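(* Consider the setting of general additive satisfaction functions described in the context. Let $\mathcal{R}$ be a mixed voting rule one of whose constituent rules is $\mathrm{MES}^{\mathrm{Value\text{-}Based}}$, and consider any execution of $\mathcal{R}$ on an instance in which this constituent rule has available budget share $\alpha$ and minimum voter budget share $\alpha^{\mathrm{Value\text{-}Based}}\ge\alpha$. Then the outcome of $\mathcal{R}$ satisfies $\alpha^{\mathrm{Value\text{-}Based}}$-budget Strong EJR+ up to any project.
   Context: Instances. An instance consists of a budget $B\in\mathbb{R}_{>0}$, a finite set $P$ of projects, an approval profile $A=(A_1,\dots,A_n)$ of voters $N=\{1,\dots,n\}$ with $A_i\subseteq P$, and costs $c:P\to\mathbb{R}_{>0}$. Write $c(P')=\sum_{p\in P'}c(p)$ and $N_p=\{i\in N: p\in A_i\}$; it is assumed that $N_p\ne\emptyset$ for all $p\in P$. In addition there is a satisfaction value $\mu(p)>0$ for each $p\in P$: voter $i$ has satisfaction $\mu_i(p)=\mu(p)$ if $p\in A_i$, $\mu_i(p)=0$ otherwise, and satisfaction is additive over sets. Voting rules. A voting rule $R$ takes an instance $I$, a rule budget $0<B_R\le B$, and a set $P_0\subseteq P$ of pre-selected projects with $c(P_0)\le B_R$, and outputs a set $R(I,B_R,P_0)=P^*$ with $P_0\subseteq P^*\subseteq P$ and $c(P^* )\le B_R$. Mixed rules. A mixed voting rule $\mathcal{R}=[R_1,\dots,R_m]$ takes an instance $I$, rule budgets $0<B_1\le\dots\le B_m\le B$, and a set $P_0\subseteq P$ with $c(P_0)\le B_1$. It computes $P_k=R_k(I,B_k,P_{k-1})$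 for $k=1,\dots,m$, and its outcome is $P_m$. The available budget share of $R_k$ is $\alpha=(B_k-c(P_{k-1}))/B$; the set of pre-selected projects for $R_k$ is $P_{k-1}$. $\mathrm{MES}^{\mathrm{Value\text{-}Based}}$ (Method of Equal Shares with Value-Based pre-allocation). Given rule budget $B_{\mathrm{MES}}$ and pre-selected set $P_0$, let $\alpha=(B_{\mathrm{MES}}-c(P_0))/B$. Let $v(p)=\frac{|N_p|\mu(p)}{c(p)}$. For $p\in P\setminus P_0$ let $U(p)=\{p'\in P_0: v(p')\ge v(p)\}$, and let $v^*=\max\{v(p): p\in P\setminus P_0,\ c(U(p))+c(p)\le B_{\mathrm{MES}}\}$, with $v^*=0$ if no such $p$ exists. (1) Payments: $\pi_i=\sum_{p\in A_i\cap P_0}\frac{\mu_i(p)}{\max\{v(p),v^*\}}$. (2) Voter budgets $(b_i)_{i\in N}$ are chosen to maximize $\min_{i\in N}(\pi_i+b_i)$ subject to $\sum_i b_i=\alpha B$ and $b_i\ge0$. (3) Starting from the selected set $P_0$, repeat: for each unselected project $p$ with $\sum_{i\in N_p}b_i\ge c(p)$ let $\rho(p)$ be the smallest number with $\sum_{i\in N_p}\min(b_i,\rho(p)\mu(p))=c(p)$; add to the selected set a project $p$ with minimum $\rho(p)$ (ties broken arbitrarily) and replace $b_i$ by $b_i-\min(b_i,\rho(p)\mu(p))$ for $i\in N_p$. Stop when $\sum_{i\in N_p}b_i<c(p)$ for every unselected $p$; the selected set is the outcome. Minimum voter budget share. $\alpha^{\mathrm{Value\text{-}Based}}=\min_{i\in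 N}(\pi_i+b_i)\frac nB$, with $(\pi_i),(b_i)$ from steps (1), (2). Axiom. For $\beta\ge0$, a set $P^*\subseteq P$ satisfies $\beta$-budget Strong EJR+ up to any project if for every $p\in P\setminus P^*$ and every $N'\subseteq N$ with $N'\cap N_p\ne\emptyset$ there is a voter $i\in N'$ with $$\sum_{p'\in(P^*\cup\{p\})\cap A_i}\mu(p')\cdot\min\left\{\frac{c(p')}{|N'\cap N_{p'}|\,\mu(p')},\frac{c(p)}{|N'\cap N_p|\,\mu(p)}\right\}>\beta\frac{B}{n}.$$ *)

(* Defs.v *)
From HB Require Import structures.
From mathcomp Require Import all_boot all_order all_algebra.
From mathcomp Require Import reals.

Set Implicit Arguments.
Unset Strict Implicit.
Unset Printing Implicit Defensive.

Import Order.TTheory GRing.Theory Num.Theory.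
Local Open Scope ring_scope.

(* Voters are numbered from 0.  There is at least one voter, so that the
   minimum over all voters is meaningful. *)
Record instance (R : realType) := Instance {
  project : finType;
  nvoters : nat;
  nvoters_gt0 : (0 < nvoters)%N;
  budget : R;
  budget_gt0 : 0 < budget;
  approval : 'I_nvoters -> {set project};
  cost : project -> R;
  cost_gt0 : forall p, 0 < cost p;
  mu : project -> R;
  mu_gt0 : forall p, 0 < mu p;
  supported : forall p, exists i, p \in approval i
}.

Arguments nvoters_gt0 {R} i.
Arguments budget {R} i.

Section Voting.

Variables (R : realType) (I : instance R).

Definition voter := 'I_(nvoters I).

Definition set_cost (W : {set project I}) : R := \sum_(p in W) cost p.

Definition supporters (p : project I) : {set voter} :=
  [set i : voter | p \in approval i].

Definition satisfaction (i : voter) (p : project I) : R :=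
  if p \in approval i then mu p else 0.

Definition min_voter (f : voter -> R) : R :=
  f [arg min_(i < Ordinal (nvoters_gt0 I)) f i]%O.

Definition valid_input (BR : R) (P0 : {set project I}) : Prop :=
  [/\ 0 < BR, BR <= budget I & set_cost P0 <= BR].

Section ValueBased.

Variables (BR : R) (P0 : {set project I}).

Definition budget_share : R := (BR - set_cost P0) / budget I.

Definition project_value (p : project I) : R :=
  #|supporters p|%:R * mu p / cost p.

Definition at_least_as_valuable (p : project I) : {set project I} :=
  [set q in P0 | project_value p <= project_value q].

(* All project values are positive, so the default value 0 of the iterated
   maximum matters only if no project satisfies the condition. *)
Definition critical_value : R :=
  \big[Num.max/0]_(p | (p \notin P0) &&
      (set_cost (at_least_as_valuable p) + cost p <= BR)) project_value p.

Definition prepayment (i : voter) : R :=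
  \sum_(p in approval i :&: P0)
    satisfaction i p / Num.max (project_value p) critical_value.

Definition feasible_budgets (b : {ffun voter -> R}) : Prop :=
  \sum_i b i = budget_share * budget I /\ (forall i, 0 <= b i).

Definition level (b : {ffun voter -> R}) : R :=
  min_voter (fun i => prepayment i + b i).

Definition voter_budgets (b : {ffun voter -> R}) : Prop :=
  feasible_budgets b /\
  (forall b', feasible_budgets b' -> level b' <= level b).

Definition min_voter_share (b : {ffun voter -> R}) : R :=
  level b * ((nvoters I)%:R / budget I).

End ValueBased.

Section EqualShares.

Implicit Types (W : {set project I}) (b : {ffun voter -> R}).

Definition affordable W b (p : project I) : Prop :=
  p \notin W /\ cost p <= \sum_(i in supporters p) b i.

Definition total_payment b (p : project I) (r : R) : R :=
  \sum_(i in supporters p) Num.min (b i) (r * mu p).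

Definition is_rho b (p : project I) (r : R) : Prop :=
  total_payment b p r = cost p /\
  (forall r', total_payment b p r' = cost p -> r <= r').

Definition pay b (p : project I) (r : R) : {ffun voter -> R} :=
  [ffun i => if i \in supporters p then b i - Num.min (b i) (r * mu p)
             else b i].

(* [mes_run W b W'] : starting from the selected set W and the voter budgets
   b, the purchasing phase can stop with the selected set W'.  It is a
   relation because ties are broken arbitrarily. *)
Inductive mes_run : {set project I} -> {ffun voter -> R} ->
    {set project I} -> Prop :=
| mes_stop W b :
    (forall p, p \notin W -> \sum_(i in supporters p) b i < cost p) ->
    mes_run W b W
| mes_buy W b p r W' :
    affordable W b p -> is_rho b p r ->
    (forall q s, affordable W b q -> is_rho b q s -> r <= s) ->
    mes_run (p |: W) (pay b p r) W' ->
    mes_run W b W'.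

Definition mes_outcome (BR : R) (P0 W : {set project I}) : Prop :=
  exists2 b, voter_budgets BR P0 b & mes_run P0 b W.

Lemma mes_run_sound W b W' : (forall i, 0 <= b i) -> mes_run W b W' ->
  W \subset W' /\ set_cost W' <= set_cost W + \sum_i b i.
Proof.
move=> b0 run; elim: run b0 => {W b W'} [W b _ b0|W b p r W' [pW _] [tot _] _ _ IH b0].
  by split=> //; rewrite lerDl sumr_ge0.
have pay_ge0 i : 0 <= pay b p r i.
  by rewrite ffunE; case: ifP => // _; rewrite subr_ge0 ge_min lexx.
have [sub le] := IH pay_ge0; split; first exact: subset_trans (subsetUr _ _) sub.
apply: le_trans le _; rewrite /set_cost big_setU1 //= [cost p + _]addrC -addrA.
rewrite lerD2l -tot /total_payment [X in X + _]big_mkcond -big_split /=.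
apply: ler_sum => i _; rewrite ffunE; case: ifP => _; last by rewrite add0r.
by rewrite addrC subrK.
Qed.

Lemma mes_outcome_sound (BR : R) (P0 W : {set project I}) :
  valid_input BR P0 -> mes_outcome BR P0 W ->
  P0 \subset W /\ set_cost W <= BR.
Proof.
move=> _ [b [[sb b0] _] run]; have [sub le] := mes_run_sound b0 run.
split=> //; apply: le_trans le _.
by rewrite sb /budget_share divfK ?gt_eqF ?budget_gt0 // addrC subrK.
Qed.

End EqualShares.

(* For i in N' and q approved by i, the intersection of N' with the supporters
   of q contains i, so no denominator below is 0. *)
Definition budget_strong_EJRplus_any (beta : R) (W : {set project I}) : Prop :=
  forall p, p \notin W ->
  forall N' : {set voter}, N' :&: supporters p != set0 ->
  exists2 i, i \in N' &
    \sum_(q in (p |: W) :&: approval i)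
       mu q * Num.min (cost q / (#|N' :&: supporters q|%:R * mu q))
                      (cost p / (#|N' :&: supporters p|%:R * mu p))
    > beta * (budget I / (nvoters I)%:R).

End Voting.

(* A voting rule is a relation between inputs and possible outcomes: this
   covers both rules that are functions and rules with arbitrary
   tie-breaking. *)
Record voting_rule (R : realType) := VotingRule {
  rule_outcome :> forall I : instance R,
    R -> {set project I} -> {set project I} -> Prop;
  rule_sound : forall (I : instance R) (BR : R) (P0 W : {set project I}),
    valid_input BR P0 -> rule_outcome BR P0 W ->
    P0 \subset W /\ set_cost W <= BR
}.

Definition mes_value_based (R : realType) : voting_rule R :=
  VotingRule (@mes_outcome_sound R).

(* Bs k is the budget of the rule Rs k, which turns Ps k into Ps k.+1; the
   initially selected set is Ps 0, the outcome is Ps m, and the values of Ps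
   beyond m are irrelevant. *)
Record mixed_execution (R : realType) (m : nat) (Rs : 'I_m -> voting_rule R)
    (I : instance R) (Bs : 'I_m -> R) (Ps : nat -> {set project I}) : Prop := {
  Bs_gt0 : forall k, 0 < Bs k;
  Bs_mono : forall j k : 'I_m, (j <= k)%N -> Bs j <= Bs k;
  Bs_le : forall k, Bs k <= budget I;
  Ps0_cost : forall k : 'I_m, k = 0%N :> nat -> set_cost (Ps 0%N) <= Bs k;
  Ps_step : forall k : 'I_m, Rs k I (Bs k) (Ps k) (Ps k.+1)
}.

(* Main.v *)
(** Fix an unselected project [p] and a group [N'] of voters, [s] of whom
    support [p].  Credit a voter with the capped share of each selected project
    she approves, and with her share of [p].

    During the purchasing phase, as long as every supporter of [p] in [N'] still
    owns [cost p / s], every purchase is at most as expensive per unit of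
    satisfaction as [p] would be for these [s] voters.  So the payments of [N']
    are covered by the credit until a voter of [N'] exhausts her budget or a
    supporter of [p] drops below [cost p / s]; that voter's credit then exceeds
    her initial budget.

    The prepayments are covered by the credit for the pre-selected projects if
    the critical value is at least the value of [p].  Otherwise [p] does not fit
    into the rule budget next to the more valuable pre-selected projects, i.e.
    the less valuable ones and the voter budgets together cost less than [p];
    hence for some supporter of [p] in [N'] the share of [p] alone outweighs
    both. *)
Require Import Defs.
From mathcomp Require Import all_boot all_order all_algebra.
From mathcomp Require Import reals.
From mathcomp Require classical_sets.
From mathcomp Require Import ring lra.

Set Implicit Arguments.
Unset Strict Implicit.
Unset Printing Implicit Defensive.

Import Order.TTheory GRing.Theory Num.Theory.
Local Open Scope ring_scope.

Section Credits.

Variables (R : realType) (I : instance R).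
Implicit Types (p q : project I) (W S : {set project I}) (i : voter I)
  (b : {ffun voter I -> R}) (r : R).

(** * Sums over voters and the price of a purchase *)

Lemma sum_lt_exists_lt (T : finType) (A : {set T}) (f : T -> R) (c : R) :
  A != set0 -> \sum_(i in A) f i < c -> exists2 i, i \in A & f i < c / #|A|%:R.
Proof.
move=> A0 lt_c; have cA : (#|A|%:R : R) != 0 by rewrite pnatr_eq0 cards_eq0.
case: (boolP [exists i in A, f i < c / #|A|%:R]) => [/exists_inP[i iA fi]|].
  by exists i.
move=> /exists_inPn none; move: lt_c; rewrite ltNge.
suff -> : c <= \sum_(i in A) f i by [].
rewrite -[leLHS](divfK cA) mulr_natr -sumr_const.
by apply: ler_sum => i iA; rewrite leNgt none.
Qed.

(** This Lipschitz bound takes the place of continuity of [total_payment] in the price. *)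
Lemma sum_min_lip (T : finType) (A : {set T}) (f : T -> R) (x y : R) :
  x <= y ->
  \sum_(i in A) Num.min (f i) y
    <= \sum_(i in A) Num.min (f i) x + #|A|%:R * (y - x).
Proof.
move=> xy; rewrite mulr_natl -sumr_const -big_split; apply: ler_sum => i _ /=.
by rewrite /Num.min; do 2 case: ltP => ? //; lra.
Qed.

Lemma total_payment_price_gt0 b p r : 0 < total_payment b p r -> 0 < r.
Proof.
rewrite !ltNge; apply: contra => r0; apply: sumr_le0 => i _.
by rewrite ge_min pmulr_lle0 ?mu_gt0 // r0 orbT.
Qed.

Lemma sum_setU (T : finType) (A B : {set T}) (f : T -> R) :
  [disjoint A & B] ->
  \sum_(i in A :|: B) f i = \sum_(i in A) f i + \sum_(i in B) f i.
Proof.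
rewrite disjoint_sym => /setDidPl dis.
by rewrite (big_setID A) setUK setDUl setDv set0U dis.
Qed.

Lemma supporters_neq0 p : supporters p != set0.
Proof.
by have [i pi] := supported p; apply/set0Pn; exists i; rewrite inE.
Qed.

(** The witness is the infimum of the prices that raise at least [cost p]; it is at least 0, since
    only positive prices raise money. *)
Lemma is_rho_exists b p r :
  (forall i, 0 <= b i) -> cost p <= total_payment b p r ->
  exists2 r0, is_rho b p r0 & r0 <= r.
Proof.
move=> b0 le_r; set c := cost p.
pose E : classical_sets.set R := fun x => c <= total_payment b p x.
have K0 : 0 < (#|supporters p|%:R : R) * mu p.
  by rewrite mulr_gt0 ?mu_gt0 // ltr0n card_gt0 supporters_neq0.
have lip x y : x <= y -> total_payment b p y <=
    total_payment b p x + #|supporters p|%:R * mu p * (y - x).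
  move=> xy; have xym : x * mu p <= y * mu p.
    by rewrite ler_wpM2r // ltW ?mu_gt0.
  apply: le_trans (sum_min_lip (supporters p) b xym) _.
  by rewrite /total_payment lerD2l -mulrBl -mulrA [mu p * _]mulrC.
have Elb : classical_sets.lbound E 0.
  move=> x cx; apply/ltW/(@total_payment_price_gt0 b p).
  exact: lt_le_trans (cost_gt0 p) cx.
have Einf : classical_sets.has_inf E by split; [exists r | exists 0].
have inf_le x : c <= total_payment b p x -> inf E <= x.
  by move=> cx; apply: ge_inf => //; exists 0.
exists (inf E); last exact: inf_le.
split=> [|x tot_x]; last by apply: inf_le; rewrite tot_x.
(* In both cases [d] is the deviation from [c] divided by the Lipschitz constant. A surplus at the
   infimum would leave [inf E - d] in [E]; a deficit would keep every price below [inf E + d] out of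
   [E]. *)
apply/le_anti/andP; split; rewrite leNgt; apply/negP => lt_c.
- have d0 : 0 < (total_payment b p (inf E) - c) /
      (#|supporters p|%:R * mu p) by rewrite divr_gt0 // subr_gt0.
  set d := _ / _ in d0.
  have: inf E <= inf E - d.
    apply: inf_le.
    have /lip : inf E - d <= inf E by rewrite gerBl ltW.
    have -> : inf E - (inf E - d) = d by ring.
    by rewrite mulrC /d divfK ?gt_eqF // /c; lra.
  lra.
- have d0 : 0 < (c - total_payment b p (inf E)) /
      (#|supporters p|%:R * mu p) by rewrite divr_gt0 // subr_gt0.
  set d := _ / _ in d0.
  have [x Ex ltx] := inf_adherent d0 Einf.
  have le_x : inf E <= x by exact: inf_le.
  have := lip _ _ le_x; rewrite leNgt => /negP; apply.
  apply: lt_le_trans Ex; rewrite -ltrBrDl mulrC -ltr_pdivlMr // -/d; lra.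
Qed.

(* Otherwise all supporters would pay their whole budgets, already at a
   smaller price. *)
Lemma is_rho_full_payer b p r :
  is_rho b p r -> exists2 i, i \in supporters p & r * mu p <= b i.
Proof.
move=> [tot min_r].
have [i0 pi0] := set0Pn _ (supporters_neq0 p).
have [i pi bmax] := @arg_maxP _ _ _ i0 (mem (supporters p)) b pi0.
exists i => //; rewrite leNgt; apply/negP => lt_b.
have := min_r (b i / mu p); rewrite leNgt ltr_pdivrMr ?mu_gt0 // lt_b.
suff e : total_payment b p (b i / mu p) = cost p by move/(_ e).
rewrite -tot; apply: eq_bigr => j pj.
rewrite divfK ?gt_eqF ?mu_gt0 // (min_l (bmax _ pj)) min_l //.
exact: le_trans (bmax _ pj) (ltW lt_b).
Qed.

(** * Credits relative to a fixed group and project *)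

Section Group.

Variables (N' : {set voter I}) (p : project I).
Hypothesis Np0 : N' :&: supporters p != set0.

Let price : R := cost p / (#|N' :&: supporters p|%:R * mu p).

Definition group_share q : R :=
  mu q * Num.min (cost q / (#|N' :&: supporters q|%:R * mu q)) price.

Definition credit i S : R := \sum_(q in S :&: approval i) group_share q.

Let size_gt0 : 0 < (#|N' :&: supporters p|%:R : R).
Proof. by rewrite ltr0n card_gt0. Qed.

Let price_mu : price * mu p = cost p / #|N' :&: supporters p|%:R.
Proof. by rewrite /price; field; rewrite !gt_eqF ?mu_gt0. Qed.

(** Here both bounds are amounts of money: an equal split of the cost of [q] within [N'], and the
    payment for [q] at [price] per unit of satisfaction. *)
Lemma group_shareE q :
  group_share q =
  Num.min (cost q / #|N' :&: supporters q|%:R) (price * mu q).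
Proof.
rewrite /group_share minr_pMr ?ltW ?mu_gt0 // [price * _]mulrC; congr Num.min.
by rewrite invfM mulrCA [mu q * _]mulrCA divff ?mulr1 // gt_eqF ?mu_gt0.
Qed.

Lemma group_share_self : group_share p = cost p / #|N' :&: supporters p|%:R.
Proof. by rewrite group_shareE price_mu minxx. Qed.

(** This includes projects without supporters in [N'], where the division by 0 yields 0. *)
Lemma group_share_ge0 q : 0 <= group_share q.
Proof.
have c0 := ltW (cost_gt0 q); have m0 := ltW (mu_gt0 q).
rewrite group_shareE le_min divr_ge0 //= mulr_ge0 //.
by rewrite divr_ge0 ?mulr_ge0 // ltW ?mu_gt0 ?cost_gt0.
Qed.

Lemma credit_sub i S S' : S \subset S' -> credit i S <= credit i S'.
Proof.
move=> sub; rewrite /credit [leRHS](big_setID (S :&: approval i)) /=.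
rewrite (setIidPr (setSI _ sub)) lerDl.
by apply: sumr_ge0 => q _; apply: group_share_ge0.
Qed.

Lemma credit_setU i S S' :
  [disjoint S & S'] -> credit i (S :|: S') = credit i S + credit i S'.
Proof.
move=> dis; rewrite /credit setIUl sum_setU //.
by rewrite -setI_eq0 setIACA (disjoint_setI0 dis) set0I.
Qed.

Lemma share_le_credit i q S :
  q \in S -> q \in approval i -> group_share q <= credit i S.
Proof.
move=> qS qi; have <- : credit i [set q] = group_share q.
  by rewrite /credit (setIidPl _) ?sub1set // big_set1.
by apply: credit_sub; rewrite sub1set.
Qed.

(** * The purchasing phase *)

Lemma poor_supporter_credit b i S :
  i \in N' :&: supporters p -> b i < cost p / #|N' :&: supporters p|%:R ->
  p \in S -> b i < credit i S.
Proof.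
rewrite 2!inE => /andP[_ pi] bi pS; apply: lt_le_trans bi _.
by rewrite -group_share_self share_le_credit.
Qed.

(** At [price], the supporters of [p] in [N'] already cover the whole cost by themselves. *)
Lemma rich_supporters_rho b :
  (forall i, 0 <= b i) ->
  (forall i, i \in N' :&: supporters p -> price * mu p <= b i) ->
  cost p <= \sum_(i in supporters p) b i /\
  exists2 r, is_rho b p r & r <= price.
Proof.
move=> b0 rich.
have le_tot : cost p <= total_payment b p price.
  have -> : cost p = \sum_(i in N' :&: supporters p) (price * mu p).
    by rewrite sumr_const price_mu -[RHS]mulr_natr divfK ?gt_eqF.
  rewrite /total_payment [leRHS](big_setID N') /= [supporters p :&: _]setIC -[leLHS]addr0 lerD //.
    by apply: ler_sum => i iN; rewrite le_min lexx rich.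
  apply: sumr_ge0 => i _; rewrite le_min b0 mulr_ge0 //; last exact/ltW/mu_gt0.
  by rewrite divr_ge0 ?mulr_ge0 // ltW ?mu_gt0 ?cost_gt0.
split; last exact: is_rho_exists.
by apply: le_trans le_tot _; apply: ler_sum => i _; rewrite ge_min lexx.
Qed.

(** Every supporter of [q] in [N'] pays at least [b i], and some supporter pays the full [r * mu q],
    which is more. Hence an equal split of the cost within [N'] exceeds [b i]. *)
Lemma exhausted_voter_share b q r i :
  (forall j, 0 <= b j) -> is_rho b q r -> r <= price ->
  i \in N' :&: supporters q -> b i < r * mu q ->
  (forall j, j \in N' :&: supporters q -> b i <= b j) ->
  b i < group_share q.
Proof.
move=> b0 rho le_r iNq lt_b bmin.
have le_m : r * mu q <= price * mu q by rewrite ler_wpM2r // ltW ?mu_gt0.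
rewrite group_shareE lt_min (lt_le_trans lt_b le_m) andbT.
rewrite ltr_pdivlMr ?ltr0n ?card_gt0; last by apply/set0Pn; exists i.
have [j qj lt_j] := is_rho_full_payer rho.
have [<- _] := rho; rewrite /total_payment (big_setID N') /= [supporters q :&: _]setIC.
rewrite mulr_natr -sumr_const.
have le_min_b k : k \in N' :&: supporters q -> b i <= Num.min (b k) (r * mu q).
  by move=> kN; rewrite le_min bmin // ltW.
have rest0 k : 0 <= Num.min (b k) (r * mu q).
  by rewrite le_min b0 (le_trans (b0 i)) ?ltW.
have pos_j : b i < Num.min (b j) (r * mu q) by rewrite min_r.
(* The strict inequality comes from [j]: from the sum over [N'] if [j] belongs to it, otherwise from
   the payments outside [N']. *)
have [jN|jN] := boolP (j \in N').
  have jNq : j \in N' :&: supporters q by rewrite inE jN.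
  rewrite -[ltLHS]addr0 ltr_leD ?sumr_ge0 //.
  rewrite (bigD1 j) //= [ltRHS](bigD1 j) //=.
  by apply: ltr_leD => //; apply: ler_sum => k /andP[kN _]; apply: le_min_b.
rewrite -[ltLHS]addr0 ler_ltD //; first exact: ler_sum.
rewrite (bigD1 j) /=; last by rewrite inE jN.
by rewrite ltr_wpDr ?sumr_ge0 // (le_lt_trans (b0 i)).
Qed.

(** Induction on the purchases. Only credit for projects outside [W] is used, so that the credit for
    the pre-selected projects remains to cover the prepayments. *)
Lemma mes_run_credit W b W' :
  mes_run W b W' -> (forall i, 0 <= b i) -> p \notin W' ->
  exists2 i, i \in N' & b i < credit i (p |: W' :\: W).
Proof.
elim=> {W b W'} [W b stop b0 pW | W b q r W' [qW _] rho rho_min run IH b0 pW'].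
  have lt_c : \sum_(i in N' :&: supporters p) b i < cost p.
    apply: le_lt_trans (stop p pW).
    by rewrite [leRHS](big_setID N') /= [supporters p :&: _]setIC lerDl sumr_ge0.
  have [i iNp bi] := sum_lt_exists_lt Np0 lt_c.
  exists i; first by move: iNp; rewrite inE => /andP[].
  by apply: poor_supporter_credit; rewrite ?setU11.
have pay_ge0 i : 0 <= pay b q r i.
  by rewrite ffunE; case: ifP => // _; rewrite subr_ge0 ge_min lexx.
have [sub _] := mes_run_sound pay_ge0 run.
have qW' : q \in W' by apply: (subsetP sub); rewrite setU11.
have qD : q \in p |: W' :\: W by rewrite !inE qW' qW orbT.
have [/exists_inP[i iNp]|/exists_inPn rich] := boolP
    [exists i in N' :&: supporters p, b i < cost p / #|N' :&: supporters p|%:R].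
  move=> bi; exists i; first by move: iNp; rewrite inE => /andP[].
  by apply: poor_supporter_credit; rewrite ?setU11.
have [|afford [r0 rho0 le_r0]] := rich_supporters_rho b0.
  by move=> i iNp; rewrite price_mu leNgt rich.
(* [p] is still affordable, so the purchased project has at most the price of [p]. *)
have le_r : r <= price.
  apply: le_trans le_r0; apply: rho_min rho0; split=> //.
  by apply: contra pW'; apply: (subsetP (subset_trans (subsetUr _ _) sub)).
have [/exists_inP[i0 i0Nq lt_b0]|/exists_inPn paid] := boolP
    [exists i in N' :&: supporters q, b i < r * mu q].
  (* Take the poorest supporter of [q] in [N']; she cannot pay the full price either. *)
  have [i iNq bmin] := @arg_minP _ _ _ i0 (mem (N' :&: supporters q)) b i0Nq.
  have lt_b : b i < r * mu q by apply: le_lt_trans (bmin _ i0Nq) lt_b0.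
  have lt_share := exhausted_voter_share b0 rho le_r iNq lt_b bmin.
  have : i \in N' :&: supporters q := iNq; rewrite 2!inE => /andP[iN qi].
  by exists i => //; apply: lt_le_trans lt_share _; apply: share_le_credit.
have [i iN lt_i] := IH pay_ge0 pW'; exists i => //.
have split_D : p |: W' :\: W = [set q] :|: (p |: W' :\: (q |: W)).
  apply/setP => x; rewrite !inE; case: (x =P q) => [->|_] //=.
  by rewrite qW qW' orbT.
have dis : [disjoint [set q] & p |: W' :\: (q |: W)].
  rewrite disjoints1 !inE eqxx /= orbF.
  by apply: contraNneq pW' => <-.
rewrite split_D credit_setU //.
move: lt_i; rewrite ffunE inE; case: ifP => qi lt_i; last first.
  apply: lt_le_trans lt_i _; rewrite lerDr sumr_ge0 // => x _.
  exact: group_share_ge0.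
have iNq : i \in N' :&: supporters q by rewrite 2!inE iN.
have rich_i j : j \in N' :&: supporters q -> r * mu q <= b j.
  by move=> jNq; rewrite leNgt paid.
(* Now all supporters of [q] in [N'] pay exactly [r * mu q], together at most the cost of [q]; so
   each payment is covered by the credit for [q]. *)
have le_share : r * mu q <= group_share q.
  rewrite group_shareE le_min [X in _ && X]ler_wpM2r ?andbT ?(ltW (mu_gt0 q)) //.
  rewrite ler_pdivlMr ?ltr0n ?card_gt0; last by apply/set0Pn; exists i.
  have [tot _] := rho; rewrite -[leRHS]tot /total_payment (big_setID N') /= [supporters q :&: _]setIC.
  rewrite mulr_natr -sumr_const -[leLHS]addr0 lerD //.
    by apply: ler_sum => j jNq; rewrite le_min lexx rich_i.
  apply: sumr_ge0 => j _; rewrite le_min b0 mulr_ge0 ?(ltW (mu_gt0 q)) //.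
  by apply/ltW/(@total_payment_price_gt0 b q); rewrite tot cost_gt0.
have := share_le_credit (set11 q) qi.
by move: lt_i; rewrite min_r ?rich_i //; lra.
Qed.

(** * Prepayments and the critical value *)

Section Prepayment.

Variables (BR : R) (P0 : {set project I}).
Local Notation vstar := (critical_value BR P0).

Lemma project_value_gt0 q : 0 < project_value q.
Proof.
by rewrite /project_value divr_gt0 ?mulr_gt0 ?mu_gt0 ?cost_gt0 //
  ltr0n card_gt0 supporters_neq0.
Qed.

Lemma prepayment_share_le q :
  mu q / Num.max (project_value q) vstar <= cost q / #|supporters q|%:R.
Proof.
have sq0 : 0 < (#|supporters q|%:R : R) by rewrite ltr0n card_gt0 supporters_neq0.
have -> : cost q / #|supporters q|%:R = mu q / project_value q.
  by rewrite /project_value; field; rewrite !gt_eqF ?mu_gt0 ?cost_gt0.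
rewrite ler_pM2l ?mu_gt0 // lef_pV2 ?posrE ?lt_max ?project_value_gt0 //.
by rewrite le_max lexx.
Qed.

(** An equal split among all supporters is at most one within [N'], and the inverse of [price] is at
    most [project_value p], since it counts only the supporters in [N']. *)
Lemma prepayment_share_le_group_share i q :
  i \in N' -> q \in approval i ->
  project_value p <= Num.max (project_value q) vstar ->
  mu q / Num.max (project_value q) vstar <= group_share q.
Proof.
move=> iN qi le_v; rewrite group_shareE le_min; apply/andP; split.
  apply: le_trans (prepayment_share_le q) _.
  rewrite ler_pM2l ?cost_gt0 // lef_pV2 ?posrE ?ltr0n ?card_gt0.
  - by rewrite ler_nat subset_leq_card // subsetIr.
  - exact: supporters_neq0.
  - by apply/set0Pn; exists i; rewrite 2!inE iN.
rewrite mulrC ler_pM2r ?mu_gt0 //.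
rewrite -[price]invrK lef_pV2 ?posrE ?lt_max ?project_value_gt0 //.
  apply: le_trans le_v; rewrite /price invf_div /project_value.
  rewrite ler_pM2r ?invr_gt0 ?cost_gt0 // ler_pM2r ?mu_gt0 //.
  by rewrite ler_nat subset_leq_card // subsetIr.
by rewrite invr_gt0 divr_gt0 ?mulr_gt0 ?mu_gt0 ?cost_gt0.
Qed.

Lemma prepaymentE i :
  prepayment BR P0 i =
  \sum_(q in P0 :&: approval i) mu q / Num.max (project_value q) vstar.
Proof.
rewrite /prepayment setIC; apply: eq_bigr => q.
by rewrite inE /satisfaction => /andP[_ ->].
Qed.

Lemma prepayment_le_credit i :
  i \in N' -> project_value p <= vstar -> prepayment BR P0 i <= credit i P0.
Proof.
move=> iN le_v; rewrite prepaymentE; apply: ler_sum => q.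
rewrite inE => /andP[_ qi]; apply: (prepayment_share_le_group_share iN qi).
by rewrite le_max le_v orbT.
Qed.

Lemma sum_cost_shares (S : {set project I}) :
  \sum_(i : voter I) \sum_(q in S :&: approval i) (cost q / #|supporters q|%:R)
    = set_cost S.
Proof.
rewrite /set_cost (exchange_big_dep (mem S)) /=; last first.
  by move=> i q _; rewrite inE => /andP[].
apply: eq_bigr => q qS.
rewrite (eq_bigl (mem (supporters q))); last by move=> i; rewrite !inE qS.
rewrite sumr_const -[LHS]mulr_natr divfK // pnatr_eq0 cards_eq0.
exact: supporters_neq0.
Qed.

Lemma unaffordable_credit b :
  p \notin P0 -> feasible_budgets BR P0 b ->
  BR < set_cost (at_least_as_valuable P0 p) + cost p ->
  exists2 i, i \in N' & prepayment BR P0 i + b i < credit i (p |: P0).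
Proof.
move=> pP0 [sumb b0] big; set U := at_least_as_valuable P0 p in big *.
have UP0 : U \subset P0 by apply/subsetP => q; rewrite inE => /andP[].
have P0split : P0 = U :|: (P0 :\: U) by rewrite -{1}(setID P0 U) (setIidPr UP0).
have disUD : [disjoint U & P0 :\: U].
  by rewrite disjoints_subset setCD subsetUr.
(* An upper bound on the prepayments for projects less valuable than [p]; over all voters it sums to
   their total cost. *)
pose low i := \sum_(q in (P0 :\: U) :&: approval i)
                cost q / #|supporters q|%:R : R.
have low0 i : 0 <= low i.
  by apply: sumr_ge0 => q _; rewrite divr_ge0 // ltW ?cost_gt0.
have lt_c : \sum_(i in N' :&: supporters p) (low i + b i) < cost p.
  have: \sum_(i in N' :&: supporters p) (low i + b i) <=
        \sum_i (low i + b i).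
    rewrite [leRHS](bigID (mem (N' :&: supporters p))) /= lerDl sumr_ge0 //.
    by move=> i _; rewrite addr_ge0.
  move=> /le_lt_trans; apply; rewrite big_split /= sum_cost_shares sumb.
  (* The total is the cost of [P0 :\: U] plus [BR] minus the cost of [P0], that is, [BR] minus the
     cost of [U]. *)
  rewrite /budget_share divfK ?gt_eqF ?budget_gt0 //.
  have -> : set_cost P0 = set_cost U + set_cost (P0 :\: U).
    by rewrite {1}P0split /set_cost sum_setU.
  lra.
have [i iNp lt_i] := sum_lt_exists_lt Np0 lt_c.
move: (iNp); rewrite 2!inE => /andP[iN pi]; exists i => //.
have disp : [disjoint [set p] & P0] by rewrite disjoints1.
rewrite credit_setU //; have := share_le_credit (set11 p) pi.
rewrite group_share_self.
suff : prepayment BR P0 i <= low i + credit i P0 by lra.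
have leU : \sum_(q in U :&: approval i) mu q / Num.max (project_value q) vstar
    <= credit i P0.
  apply: le_trans (credit_sub i UP0); apply: ler_sum => q.
  rewrite 2!inE => /andP[/andP[_ le_q] qi].
  by apply: (prepayment_share_le_group_share iN qi); rewrite le_max le_q.
rewrite prepaymentE {1}P0split setIUl sum_setU; last first.
  by rewrite -setI_eq0 setIACA (disjoint_setI0 disUD) set0I.
rewrite addrC lerD //; apply: ler_sum => q _; exact: prepayment_share_le.
Qed.

Lemma mes_credit b W :
  feasible_budgets BR P0 b -> mes_run P0 b W -> p \notin W ->
  exists2 i, i \in N' & prepayment BR P0 i + b i < credit i (p |: W).
Proof.
move=> feas run pW; have [_ b0] := feas.
have [sub _] := mes_run_sound b0 run.
have pP0 : p \notin P0 by apply: contra pW; apply: (subsetP sub).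
have [fits|] := leP (set_cost (at_least_as_valuable P0 p) + cost p) BR; last first.
  move=> /(unaffordable_credit pP0 feas)[i iN lt_i]; exists i => //.
  by apply: lt_le_trans lt_i _; apply: credit_sub; apply: setUS.
(* [p] itself is a candidate in the maximum that defines the critical value. *)
have le_v : project_value p <= vstar.
  by rewrite /critical_value le_bigmax_cond ?pP0.
have [i iN lt_i] := mes_run_credit run b0 pW; exists i => //.
have -> : p |: W = P0 :|: (p |: W :\: P0).
  by rewrite setUCA -{1}(setID W P0) (setIidPr sub).
rewrite credit_setU; first by apply: ler_ltD lt_i; apply: prepayment_le_credit.
by rewrite disjoint_sym disjoints_subset subUset sub1set inE pP0 subsetDr.
Qed.

End Prepayment.

End Group.

Lemma level_le BR P0 b i : level BR P0 b <= prepayment BR P0 i + b i.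
Proof. by rewrite /level /min_voter; case: arg_minP => // j _; apply. Qed.

End Credits.

(** * Mixed rules and the final bound *)

Lemma mixed_execution_sub (R : realType) (m : nat) (Rs : 'I_m -> voting_rule R)
    (I : instance R) (Bs : 'I_m -> R) (Ps : nat -> {set project I})
    (j l : nat) :
  mixed_execution Rs Bs Ps -> (j <= l <= m)%N -> Ps j \subset Ps l.
Proof.
(* Soundness of a rule presupposes a valid input, so the induction carries the cost bound along with
   the inclusion. *)
move=> ex; have sound n (lt_n : (n < m)%N) :
    Ps n \subset Ps n.+1 /\ set_cost (Ps n.+1) <= Bs (Ordinal lt_n).
  elim: n lt_n => [|n IH] lt_n; apply: rule_sound (Ps_step ex (Ordinal lt_n));
    split; rewrite ?(Bs_gt0 ex) ?(Bs_le ex) //.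
    exact: (Ps0_cost ex).
  apply: le_trans (IH (ltnW lt_n)).2 _.
  by apply: (Bs_mono ex); rewrite /= leqnSn.
elim: l => [|l IH]; first by rewrite leqn0 => /andP[/eqP-> _].
rewrite leq_eqVlt => /andP[/predU1P[->//|le_j] lt_l].
by apply: subset_trans (IH _) (sound l lt_l).1; rewrite -ltnS le_j ltnW.
Qed.

Theorem theorem7p2 (R : realType) (m : nat) (Rs : 'I_m -> voting_rule R)
    (I : instance R) (Bs : 'I_m -> R) (Ps : nat -> {set project I})
    (k : 'I_m) (b : {ffun voter I -> R}) :
  mixed_execution Rs Bs Ps ->
  Rs k = mes_value_based R ->
  voter_budgets (Bs k) (Ps k) b ->
  budget_share (Bs k) (Ps k) <= min_voter_share (Bs k) (Ps k) b ->
  budget_strong_EJRplus_any (min_voter_share (Bs k) (Ps k) b) (Ps m).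
Proof.
move=> ex Rk [feas_b _] _ p pm N' Np0.
(* The execution brings its own maximizer [b'], possibly different from [b]; by maximality the level
   of [b] is at most that of [b']. *)
have := Ps_step ex k; rewrite Rk => -[b' [feas_b' max_b'] run].
have sub : Ps k.+1 \subset Ps m.
  by apply: (mixed_execution_sub ex); rewrite ltn_ord leqnn.
have pk : p \notin Ps k.+1 by apply: contra pm; apply: (subsetP sub).
have [i iN lt_i] := mes_credit Np0 feas_b' run pk; exists i => //.
rewrite /min_voter_share -mulrA.
have -> : (nvoters I)%:R / budget I * (budget I / (nvoters I)%:R) = 1.
  by field; rewrite !gt_eqF ?budget_gt0 ?ltr0n ?nvoters_gt0.
rewrite mulr1; apply: le_lt_trans (max_b' _ feas_b) _.
apply: le_lt_trans (level_le _ _ _ i) _; apply: lt_le_trans lt_i _.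
exact: (@credit_sub _ _ N' p i _ _ (setUS _ sub)).
Qed.
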